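(* Let $p$ be an odd prime, $P=A\times B\subseteq\mathbb{F}_p^2\times\mathbb{F}_p^2$ and $S\subseteq SL_2(\mathbb{F}_p)$. Then \[\left|I(P,S)-\frac{|P||S|}{p^2}\right|\ll p\sqrt{|S||P|}+|S|.\] Moreover, let $k_A$ and $k_B$ be the maximal number of points of $A$, respectively $B$, on a line through the origin, and let $k=\min\{k_A,k_B\}$. Then \[\left|I(P,S)-\frac{|P||S|}{p^2}\right|\ll p^{1/2}k^{1/2}\sqrt{|S||P|}+|S|.\]
   Context: For $x,y\in\mathbb{F}_p^2$ and $\theta\in SL_2(\mathbb{F}_p)$, the pair $(x,y)$ is incident to $\theta$ if $\theta y=x$ (matrix acting on column vector). $I(P,S)$ is the number of pairs $((x,y),\theta)\in P\times S$ with $\theta y=x$. A line through the origin is a one-dimensional subspace of $\mathbb{F}_p^2$. $X\ll Y$ means $X\le CY$ for an absolute constant $C$ independent of $p,A,B,S$. *)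

(* Defs.v *)
From mathcomp Require Import all_boot all_order all_algebra.
From mathcomp Require Import reals.

Set Implicit Arguments.
Unset Strict Implicit.
Unset Printing Implicit Defensive.

Import GRing.Theory Num.Theory.
Local Open Scope ring_scope.

Definition SL2 (p : nat) : {set 'M['F_p]_2} := [set M | \det M == 1].

Definition incidences (p : nat) (P : {set 'cV['F_p]_2 * 'cV['F_p]_2})
    (S : {set 'M['F_p]_2}) : nat :=
  #|[set t : ('cV['F_p]_2 * 'cV['F_p]_2) * 'M['F_p]_2 |
      [&& t.1 \in P, t.2 \in S & t.2 *m t.1.2 == t.1.1]]|.

Definition points_on (p : nat) (A : {set 'cV['F_p]_2})
    (L : {vspace 'cV['F_p]_2}) : nat :=
  #|[set x in A | x \in L]|.

(* Stated as a relation because {vspace _} carries no finType structure over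
   which \max could range; k exists and is unique for every A. *)
Definition is_max_on_line (p : nat) (A : {set 'cV['F_p]_2}) (k : nat) : Prop :=
  (exists L : {vspace 'cV['F_p]_2}, \dim L = 1%N /\ points_on A L = k) /\
  (forall L : {vspace 'cV['F_p]_2}, \dim L = 1%N -> (points_on A L <= k)%N).

(* Main.v *)
(** Let f(t) be the number of points of P incident to t, where zero vectors
have been discarded, and q = p. Since sum f = q |P| over SL_2, Cauchy-Schwarz
over S reduces the bound to the variance of f over SL_2, that is, to counting
pairs u, v in P with a common incident matrix. If the second components of u, v
are independent there is at most one such matrix, and only when the symplectic
form det(v.1, u.1) - det(v.2, u.2) vanishes; proportional pairs u, v
contribute at most q k |P|.

The number W of pairs in P orthogonal for this form is at most
|P|^2/q + q k |P|: the deviation d(v) = h(v) - |P|/q, with h(v) the number of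
points of P orthogonal to v, is constant on punctured lines, so its sum over P
is a pairing of d with the multiplicity function of the dilates of P, and the
second moments of both are controlled by k. *)

Require Import Defs.
From mathcomp Require Import all_boot all_order all_algebra.
From mathcomp Require Import reals.
From mathcomp Require Import ring lra.

Set Implicit Arguments.
Unset Strict Implicit.
Unset Printing Implicit Defensive.

Import Order.TTheory GRing.Theory Num.Theory.
Local Open Scope ring_scope.


(** * Points on hyperplanes of a finite vector space *)

Lemma sum_nat_of_bool (R : pzSemiRingType) (T : finType) (D : {pred T}) (b : pred T) :
  \sum_(x in D) (b x)%:R = #|[set x in D | b x]|%:R :> R.
Proof.
rewrite (eq_bigr (fun x => if b x then 1 else 0)); last by move=> x _; case: (b x).
by rewrite -big_mkcondr /= sumr_const cardsE.
Qed.

Lemma sum_nat_of_bool_all (R : pzSemiRingType) (T : finType) (b : pred T) :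
  \sum_x (b x)%:R = #|[set x | b x]|%:R :> R.
Proof. exact: (sum_nat_of_bool R T b). Qed.

(** Coordinates in a row basis of [kermx M] parametrise the solutions, and this kernel has dimension
    [n - \rank M]. *)
Lemma card_left_kernel (F : finFieldType) n m (M : 'M[F]_(n, m)) :
  #|[set w : 'rV_n | w *m M == 0]| = (#|F| ^ (n - \rank M))%N.
Proof.
rewrite -mxrank_ker.
set r := \rank (kermx M).
have -> : [set w : 'rV_n | w *m M == 0] = [set a *m row_base (kermx M) | a in [set: 'rV_r]].
  apply/setP=> w; rewrite inE -sub_kermx -(eq_row_base (kermx M)).
  apply/submxP/imsetP=> [[D ->]|[D _ ->]]; by exists D.
rewrite card_imset; last by apply: row_free_inj; apply: row_base_free.
by rewrite cardsT card_mx mul1n.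
Qed.


Lemma card_hyperplane (F : finFieldType) n (J : 'M[F]_n.+1) (u : 'rV_n.+1) :
  J \in unitmx -> u != 0 ->
  #|[set w : 'rV_n.+1 | w *m J *m u^T == 0]| = (#|F| ^ n)%N.
Proof.
move=> uJ u0; under eq_finset => w do rewrite -mulmxA.
rewrite card_left_kernel -mxrank_tr trmx_mul trmxK mxrankMfree ?row_free_unit ?unitmx_tr //.
by rewrite rank_rV u0 subSS subn0.
Qed.

(** Independent [u] and [v] impose conditions of joint rank two. When [v] is a multiple of [u], the
    bound simply drops the second condition. *)
Lemma card_two_hyperplanes (F : finFieldType) n (J : 'M[F]_n.+2) (u v : 'rV_n.+2) :
  J \in unitmx -> u != 0 ->
  (#|[set w : 'rV_n.+2 | (w *m J *m u^T == 0) && (w *m J *m v^T == 0)]%R|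
    <= if (v <= u)%MS then #|F| ^ n.+1 else #|F| ^ n)%N.
Proof.
move=> uJ u0; case: ifP => vu.
  rewrite -(card_hyperplane uJ u0); apply/subset_leq_card/subsetP => w.
  by rewrite !inE => /andP[].
under eq_finset => w do
  rewrite -row_mx_eq0 -mul_mx_row -tr_col_mx -mulmxA.
rewrite card_left_kernel -mxrank_tr trmx_mul trmxK mxrankMfree ?row_free_unit ?unitmx_tr //.
rewrite leq_pexp2l ?(ltnW (card_finNzRing_gt1 F)) //.
have <- : \rank (u + v) = \rank (col_mx u v) by rewrite addsmxE.
have : (u < u + v)%MS by rewrite ltmxE addsmxSl addsmx_sub submx_refl /= vu.
move/rank_ltmx; rewrite rank_rV u0 leq_subLR => r2.
by rewrite -[n.+2]/(2 + n)%N leq_add2r.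
Qed.

(** * Moments of the number of orthogonal points *)

Definition incidence_count (R : pzSemiRingType) (F : finFieldType) n (J : 'M[F]_n)
    (P : {set 'rV[F]_n}) (w : 'rV_n) : R :=
  \sum_(u in P) (w *m J *m u^T == 0)%:R.

Lemma sum_incidence_count (R : pzSemiRingType) (F : finFieldType) n (J : 'M[F]_n.+1)
    (P : {set 'rV[F]_n.+1}) :
  J \in unitmx -> 0 \notin P ->
  \sum_w incidence_count R J P w = #|P|%:R * #|F|%:R ^+ n.
Proof.
move=> uJ P0; rewrite exchange_big /= (eq_bigr (fun=> #|F|%:R ^+ n)).
  by rewrite sumr_const mulr_natl.
move=> u uP; rewrite -natrX -(card_hyperplane uJ (u := u)).
  exact: sum_nat_of_bool_all.
by apply: contraNneq P0 => <-.
Qed.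

(** Expanding the square counts triples [w], [u], [v] with [w] orthogonal to both others. Every pair
    [u], [v] is charged the generic [#|F| ^ n]; the at most [k] multiples [v] of [u] pay the
    excess. *)
Lemma sum_sqr_incidence_count (R : realFieldType) (F : finFieldType) n (J : 'M[F]_n.+2)
    (P : {set 'rV[F]_n.+2}) (k : nat) :
  J \in unitmx -> 0 \notin P ->
  (forall u, u \in P -> #|[set v in P | (v <= u)%MS]| <= k)%N ->
  \sum_w incidence_count R J P w ^+ 2
    <= #|P|%:R ^+ 2 * #|F|%:R ^+ n
       + #|P|%:R * k%:R * (#|F|%:R ^+ n.+1 - #|F|%:R ^+ n).
Proof.
move=> uJ P0 hk.
under eq_bigr => w _ do rewrite expr2 /incidence_count big_distrlr /=.
rewrite exchange_big /=.
have -> : #|P|%:R ^+ 2 * #|F|%:R ^+ n + #|P|%:R * k%:R * (#|F|%:R ^+ n.+1 - #|F|%:R ^+ n) =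
  \sum_(u in P) (#|P|%:R * #|F|%:R ^+ n + k%:R * (#|F|%:R ^+ n.+1 - #|F|%:R ^+ n)) :> R.
  by rewrite sumr_const -[RHS]mulr_natl; ring.
apply: ler_sum => u uP; rewrite exchange_big /=.
have u0 : u != 0 by apply: contraNneq P0 => <-.
have dq : 0 <= #|F|%:R ^+ n.+1 - #|F|%:R ^+ n :> R.
  by rewrite subr_ge0 -!natrX ler_nat leq_pexp2l // ltnW // card_finNzRing_gt1.
apply: (@le_trans _ _ (\sum_(v in P) (#|F|%:R ^+ n
    + (v <= u)%MS%:R * (#|F|%:R ^+ n.+1 - #|F|%:R ^+ n)))).
  apply: ler_sum => v vP.
  under eq_bigr => w _ do rewrite -natrM mulnb.
  rewrite sum_nat_of_bool_all.
  have := card_two_hyperplanes v uJ u0.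
  rewrite -(ler_nat R) => H; apply: (le_trans H).
  by case: ifP => _; rewrite natrX ?mul1r ?mul0r ?addr0 // addrC subrK.
rewrite big_split /= sumr_const -mulr_suml sum_nat_of_bool -[X in X + _]mulr_natl.
by rewrite lerD2l ler_wpM2r // ler_nat hk.
Qed.


(** * Dilates and orthogonal pairs inside a point set *)

Lemma incidence_countZ (R : pzSemiRingType) (F : finFieldType) n (J : 'M[F]_n)
    (P : {set 'rV[F]_n}) (c : F) (w : 'rV_n) :
  c != 0 -> incidence_count R J P (c *: w) = incidence_count R J P w.
Proof.
move=> c0; apply: eq_bigr => u _.
by rewrite -!scalemxAl scaler_eq0 (negPf c0).
Qed.

(** This is the multiplicity function of the nonzero dilates of [P]. It turns the sum over [P] of a
    dilation-invariant function into a sum over the whole space, where second moments are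
    available. *)
Definition dilation_count (R : pzSemiRingType) (F : finFieldType) n
    (P : {set 'rV[F]_n}) (w : 'rV_n) : R :=
  \sum_(v in P) \sum_(c | c != 0) (c *: v == w)%:R.

(** Each of the [#|F|.-1] dilations of a point [v] contributes the same value [f v]. *)
Lemma sum_dilation_count (R : comPzSemiRingType) (F : finFieldType) n
    (P : {set 'rV[F]_n}) (f : 'rV[F]_n -> R) :
  (forall c w, c != 0 -> f (c *: w) = f w) ->
  \sum_w dilation_count R P w * f w = #|F|.-1%:R * \sum_(v in P) f v.
Proof.
move=> fZ; under eq_bigr => w _ do rewrite mulr_suml.
rewrite exchange_big mulr_sumr /=; apply: eq_bigr => v _.
under eq_bigr => w _ do rewrite mulr_suml.
rewrite exchange_big /= (eq_bigr (fun=> f v)).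
  by rewrite sumr_const cardC1 mulr_natl.
move=> c c0; rewrite (bigD1 (c *: v)) //= eqxx mul1r fZ // big1 ?addr0 // => w.
by rewrite eq_sym => /negPf ->; rewrite mul0r.
Qed.

(** The multiplicity function is itself dilation invariant, so pairing it with itself leaves its sum
    over [P]. For given [u] and [v] at most one scalar takes [v] to [u], and only if [v] lies on the
    line of [u]. *)
Lemma sum_sqr_dilation_count (R : realFieldType) (F : finFieldType) n
    (P : {set 'rV[F]_n}) (k : nat) :
  0 \notin P -> (forall u, u \in P -> #|[set v in P | (v <= u)%MS]| <= k)%N ->
  \sum_w dilation_count R P w ^+ 2 <= #|F|.-1%:R * #|P|%:R * k%:R.
Proof.
move=> P0 hk.
have GZ c (w : 'rV[F]_n) : c != 0 -> dilation_count R P (c *: w) = dilation_count R P w.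
  move=> c0; apply: eq_bigr => v _.
  rewrite (reindex_inj (mulfI c0)) /=.
  apply: eq_big => [d|d _]; first by rewrite mulf_eq0 (negPf c0).
  by rewrite -scalerA (inj_eq (scalerI c0)).
under eq_bigr => w _ do rewrite expr2.
rewrite (sum_dilation_count P GZ) -mulrA ler_wpM2l // mulr_natl -sumr_const.
apply: ler_sum => u uP; apply: (@le_trans _ _ (\sum_(v in P) (v <= u)%MS%:R)).
  apply: ler_sum => v vP; have v0 : v != 0 by apply: contraNneq P0 => <-.
  have [/sub_rVP[a ev]|nvu] := boolP (v <= u)%MS; last first.
    rewrite big1 // => c c0; case: eqP => // E.
    by case/negP: nvu; rewrite -(scalerK c0 v) E scalemx_sub.
  have a0 : a != 0 by apply: contraNneq v0 => a0; rewrite ev a0 scale0r.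
  have u0 : u != 0 by apply: contraNneq v0 => u0; rewrite ev u0 scaler0.
  rewrite (bigD1 a^-1) ?invr_eq0 //= big1 ?addr0 ?lern1 ?leq_b1 // => c /andP[c0 ca].
  case: eqP => // E; case/eqP: ca; apply: (mulIf a0); rewrite mulVf //.
  apply/eqP; rewrite -subr_eq0.
  have /eqP: (c * a - 1) *: u = 0 by rewrite scalerBl -scalerA -ev E scale1r subrr.
  by rewrite scaler_eq0 (negPf u0) orbF.
by rewrite sum_nat_of_bool ler_nat hk.
Qed.

Lemma sum_incidence_count_on (R : realFieldType) (F : finFieldType) (J : 'M[F]_4)
    (P : {set 'rV[F]_4}) (k : nat) :
  J \in unitmx -> 0 \notin P ->
  (forall u, u \in P -> #|[set v in P | (v <= u)%MS]| <= k)%N ->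
  \sum_(v in P) incidence_count R J P v
    <= #|P|%:R ^+ 2 / #|F|%:R + #|F|%:R * k%:R * #|P|%:R.
Proof.
move=> uJ P0 hk.
set h := incidence_count R J P; set q : R := #|F|%:R; set m : R := #|P|%:R.
have q1 : 1 < q by rewrite ltr1n card_finNzRing_gt1.
have q0 : 0 < q by lra.
have eq1 : #|F|.-1%:R = q - 1 :> R.
  by rewrite -subn1 natrB // ltnW // card_finNzRing_gt1.
pose d w := h w - m / q.
have dZ c w : c != 0 -> d (c *: w) = d w.
  by move=> c0; rewrite /d /h incidence_countZ.
(* The mean of [h] is exactly [m / q], so all terms in [m ^+ 2] cancel and only the excess from
   proportional points is left. *)
have Sd2 : \sum_w d w ^+ 2 <= q ^+ 2 * (q - 1) * k%:R * m.
  under eq_bigr => w _ do rewrite /d sqrrB.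
  rewrite big_split /= sumrB sumr_const card_mx mul1n sumrMnl.
  rewrite -mulr_suml (sum_incidence_count R uJ P0) -[X in _ + X]mulr_natl natrX.
  have := sum_sqr_incidence_count R uJ P0 hk; rewrite -/h -/q -/m => H.
  rewrite [X in _ - X + _](_ : _ = 2 * m ^+ 2 * q ^+ 2).
  rewrite [X in _ - _ + X](_ : _ = m ^+ 2 * q ^+ 2).
  nra.
  by rewrite -/q; field; lra.
  by rewrite -/q -/m -mulr_natl; field; lra.
have := sum_sqr_dilation_count R P0 hk; rewrite eq1 -/m => SG2.
have : \sum_w dilation_count R P w * d w <= q * (q - 1) * k%:R * m.
  (* Weighted AM-GM: the weight [q] balances the two second moments, whose bounds differ by the
     factor [q ^+ 2]. *)
  apply: (@le_trans _ _ (\sum_w (d w ^+ 2 / (2 * q) + q / 2 * dilation_count R P w ^+ 2))).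
    apply: ler_sum => w _; set x := d w; set y := dilation_count R P w.
    have : 0 <= (x - q * y) ^+ 2 / (2 * q) by rewrite divr_ge0 ?sqr_ge0 //; lra.
    rewrite (_ : _ / _ = x ^+ 2 / (2 * q) + q / 2 * y ^+ 2 - y * x); first by lra.
    by field; lra.
  rewrite big_split /= -mulr_suml -mulr_sumr.
  have -> : q * (q - 1) * k%:R * m =
     q ^+ 2 * (q - 1) * k%:R * m / (2 * q) + q / 2 * ((q - 1) * m * k%:R) by field; lra.
  by rewrite lerD // ?ler_wpM2r ?ler_wpM2l ?invr_ge0 //; lra.
(* By invariance of [d] the pairing is [q - 1] times the sum of [d] over [P], and the factor [q - 1]
   cancels. *)
rewrite (sum_dilation_count P dZ) eq1 sumrB sumr_const -[(_ / _) *+ _]mulr_natl -/m.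
rewrite (_ : q * (q - 1) * k%:R * m = (q - 1) * (q * k%:R * m)); last by ring.
rewrite ler_pM2l; last by lra.
by rewrite expr2 -mulrA; lra.
Qed.


(** * Two-by-two matrices and the action of SL_2 on the plane *)

Lemma det_mx22 (R : comPzRingType) (M : 'M[R]_2) :
  \det M = M 0 0 * M 1 1 - M 0 1 * M 1 0.
Proof.
rewrite (expand_det_row _ 0) !big_ord_recl big_ord0 addr0 /cofactor !det_mx11 !mxE /=.
rewrite expr0 mul1r expr1 mulN1r mulrN.
by congr (M _ _ * M _ _ - M _ _ * M _ _); apply: val_inj.
Qed.

Definition mx22 (R : pzSemiRingType) (a b c d : R) : 'M[R]_2 :=
  \matrix_(i, j) (if i == 0 then if j == 0 then a else b
                  else if j == 0 then c else d).

Lemma det_mx22E (R : comPzRingType) (a b c d : R) : \det (mx22 a b c d) = a * d - b * c.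
Proof. by rewrite det_mx22 !mxE. Qed.

Lemma mulmx22 (R : pzSemiRingType) (a b c d a' b' c' d' : R) :
  mx22 a b c d *m mx22 a' b' c' d' =
  mx22 (a * a' + b * c') (a * b' + b * d') (c * a' + d * c') (c * b' + d * d').
Proof.
apply/matrixP => i j; rewrite !mxE !big_ord_recl big_ord0 addr0 !mxE /=.
by case: (i == 0); case: (j == 0).
Qed.

Lemma row_mx22 (R : pzSemiRingType) (x y : 'cV[R]_2) :
  row_mx x y = mx22 (x 0 0) (y 0 0) (x 1 0) (y 1 0) :> 'M_2.
Proof.
apply/matrixP => i j; rewrite [RHS]mxE.
have [j0|j1] : j = @lshift 1 1 0 \/ j = @rshift 1 1 0.
- by case: j => [[|[|//]]] ?; [left|right]; apply: val_inj.
- by rewrite j0 (row_mxEl x y); case: i => [[|[|//]]] ? /=; congr (x _ _); apply: val_inj.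
- by rewrite j1 (row_mxEr x y); case: i => [[|[|//]]] ? /=; congr (y _ _); apply: val_inj.
Qed.

Lemma col2_neq0 (R : nmodType) (x : 'cV[R]_2) : (x != 0) = (x 0 0 != 0) || (x 1 0 != 0).
Proof.
rewrite -negb_and; congr negb; apply/eqP/andP => [->|[/eqP x0 /eqP x1]].
  by rewrite !mxE.
apply/matrixP => i j; rewrite ord1 mxE.
by case: i => [[|[|//]]] Hi; [rewrite -[RHS]x0 | rewrite -[RHS]x1]; congr (x _ _); apply: val_inj.
Qed.

Lemma mx22_eta (R : pzSemiRingType) (M : 'M[R]_2) :
  M = mx22 (M 0 0) (M 0 1) (M 1 0) (M 1 1).
Proof.
apply/matrixP => i j; rewrite mxE.
by case: i => [[|[|//]]] Hi; case: j => [[|[|//]]] Hj /=; congr (M _ _); apply: val_inj.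
Qed.

(** The second column can be supported on one coordinate, its entry being, up to sign, the inverse
    of a nonzero entry of [x]. *)
Lemma det1_completion (F : fieldType) (x : 'cV[F]_2) :
  x != 0 -> exists y : 'cV[F]_2, \det (row_mx x y : 'M_2) = 1.
Proof.
rewrite col2_neq0 => /orP[] xi0.
  exists (\col_i (if i == 0 then 0 else (x 0 0)^-1)).
  by rewrite row_mx22 det_mx22E !mxE /= divff // mul0r subr0.
exists (\col_i (if i == 0 then - (x 1 0)^-1 else 0)).
by rewrite row_mx22 det_mx22E !mxE /= mulr0 sub0r mulNr opprK mulVf.
Qed.

(** The stabiliser of the first basis vector consists of the unipotent matrices [mx22 1 c 0 1]. *)
Lemma card_sl2_stab_e1 (F : finFieldType) :
  #|[set M : 'M[F]_2 | (\det M == 1) && (col 0 M == delta_mx 0 0)]| = #|F|.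
Proof.
have inj : injective (fun c : F => mx22 1 c 0 1).
  by move=> c d /matrixP /(_ 0 1); rewrite !mxE.
rewrite -[RHS](card_imset F inj); apply: eq_card => M; rewrite !inE.
apply/andP/imsetP => [[dM /eqP eM]|[c _ ->]].
  have M0 : M 0 0 = 1 by move/matrixP/(_ 0 0): eM; rewrite !mxE.
  have M1 : M 1 0 = 0 by move/matrixP/(_ 1 0): eM; rewrite !mxE.
  exists (M 0 1) => //; rewrite {1}[M]mx22_eta M0 M1.
  by move: dM; rewrite det_mx22 M0 M1 mul1r mulr0 subr0 => /eqP ->.
rewrite det_mx22E mul1r mulr0 subr0 eqxx; split=> //; apply/eqP/matrixP => i j.
by rewrite !mxE ord1; case: i => [[|[|//]]].
Qed.

Lemma col0_row_mx (R : pzSemiRingType) (x y : 'cV[R]_2) : col 0 (row_mx x y : 'M_2) = x.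
Proof.
rewrite row_mx22; apply/matrixP => i j; rewrite !mxE ord1 /=.
by case: i => [[|[|//]]] Hi; congr (x _ _); apply: val_inj.
Qed.

(** If [X] and [Y] in SL_2 carry the first basis vector to [x] and [y], then [M] maps to
    [X *m M *m invmx Y] bijectively from the stabiliser of that vector onto the matrices taking [y]
    to [x]. *)
Lemma card_sl2_transporter (F : finFieldType) (x y : 'cV[F]_2) :
  x != 0 -> y != 0 ->
  #|[set t : 'M[F]_2 | (\det t == 1) && (t *m y == x)]| = #|F|.
Proof.
move=> /det1_completion[x' dX] /det1_completion[y' dY].
set X : 'M_2 := row_mx x x' in dX; set Y : 'M_2 := row_mx y y' in dY.
have eX : X *m delta_mx 0 0 = x by rewrite -colE col0_row_mx.
have eY : Y *m delta_mx 0 0 = y by rewrite -colE col0_row_mx.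
have uX : X \in unitmx by rewrite unitmxE dX unitr1.
have uY : Y \in unitmx by rewrite unitmxE dY unitr1.
have inj : injective (fun M => X *m M *m invmx Y).
  move=> M N /(congr1 (mulmxr Y)) /=; rewrite !mulmxKV //.
  by move/(congr1 (mulmx (invmx X))); rewrite !mulKmx.
rewrite -[RHS]card_sl2_stab_e1 -[RHS](card_imset _ inj); apply: eq_card => t; rewrite !inE.
apply/andP/imsetP => [[/eqP dt /eqP et]|[M]].
  exists (invmx X *m t *m Y); last by rewrite !mulmxA mulmxV // mul1mx mulmxK.
  rewrite inE !det_mulmx det_inv dX dt dY invr1 !mulr1 eqxx /=.
  by rewrite colE -!mulmxA eY et -eX mulKmx.
rewrite inE colE => /andP[/eqP dM /eqP eM] ->.
rewrite !det_mulmx det_inv dX dY dM invr1 !mulr1; split=> //.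
by rewrite -eY mulmxA mulmxKV // -mulmxA eM eX.
Qed.

(** Fibring over the image of the first basis vector gives [#|F|] matrices for each nonzero image,
    and there are at most [#|F| ^ 2] images. *)
Lemma card_sl2_le (F : finFieldType) : (#|[set t : 'M[F]_2 | \det t == 1]%R| <= #|F| ^ 3)%N.
Proof.
pose e : 'cV[F]_2 := delta_mx 0 0.
have e0 : e != 0 by rewrite col2_neq0 mxE oner_eq0.
rewrite -sum1_card (partition_big (mulmx^~ e) (fun x => x != 0)) /=; last first.
  move=> t; rewrite inE => /eqP dt.
  by rewrite -{1}(mulmx0 _ t) (inj_eq (can_inj (mulKmx _))) // unitmxE dt unitr1.
rewrite (eq_bigr (fun=> #|F|)) => [|x x0].
  rewrite sum_nat_const expnS mulnC leq_mul2l; apply/orP; right.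
  by rewrite -[2%N]/(2 * 1)%N -card_mx max_card.
rewrite sum1_card -(card_sl2_transporter x0 e0); apply: eq_card => t.
by rewrite [RHS]inE unfold_in inE.
Qed.

(** * The symplectic form on pairs of vectors *)

(** As vectors of dimension four, pairs fall under the hyperplane counts, and a common scaling of
    both components becomes row-space inclusion. *)
Definition pair_row (R : Type) (u : 'cV[R]_2 * 'cV[R]_2) : 'rV[R]_4 := row_mx u.1^T u.2^T.

(** Gram matrix of the symplectic form: the determinant on first components minus the determinant on
    second components. *)
Definition pair_form (R : nzRingType) : 'M[R]_4 :=
  block_mx (mx22 0 1 (-1) 0) 0 0 (- mx22 0 1 (-1) 0) : 'M_(2 + 2).

(** The symplectic block squares to minus the identity, so the inverse is [- pair_form R]. *)
Lemma pair_form_unit (R : comUnitRingType) : pair_form R \in unitmx.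
Proof.
have KK : mx22 0 1 (-1) 0 *m mx22 0 1 (-1) 0 = - 1%:M :> 'M[R]_2.
  rewrite mulmx22 [RHS]mx22_eta !mxE /=; congr mx22; ring.
have JJ : pair_form R *m - pair_form R = 1%:M.
  rewrite mulmxN /pair_form (mulmx_block (mx22 0 1 (-1) 0) 0 0 _ (mx22 0 1 (-1) 0)).
  rewrite !(mulmx0, mul0mx, addr0, add0r) mulmxN mulNmx opprK KK.
  by rewrite (opp_block_mx (- 1%:M : 'M[R]_2) 0 0) opprK oppr0 -(@scalar_mx_block _ 2 2).
by case/mulmx1_unit: JJ.
Qed.

Lemma pair_formE (R : comNzRingType) (u v : 'cV[R]_2 * 'cV[R]_2) :
  (pair_row v *m pair_form R *m (pair_row u)^T == 0) =
  (\det (row_mx v.1 u.1 : 'M_2) == \det (row_mx v.2 u.2 : 'M_2)).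
Proof.
have K (a b : 'cV[R]_2) : (a^T *m mx22 0 1 (-1) 0 *m b) = (\det (row_mx a b : 'M_2))%:M.
  rewrite row_mx22 det_mx22E [LHS]mx11_scalar; congr (_%:M).
  rewrite !mxE !big_ord_recl big_ord0 !mxE !big_ord_recl !big_ord0 !mxE /=.
  rewrite (_ : lift ord0 ord0 = 1); last exact: val_inj.
  by ring.
rewrite /pair_row /pair_form (mul_row_block v.1^T v.2^T (mx22 0 1 (-1) 0) 0 0 (- mx22 0 1 (-1) 0)).
rewrite (tr_row_mx u.1^T u.2^T) !trmxK.
rewrite (mul_row_col _ _ u.1 u.2) !(mulmx0, addr0, add0r) mulmxN mulNmx !K.
rewrite subr_eq0; apply/eqP/eqP => [/matrixP/(_ 0 0)|->//].
by rewrite !mxE eqxx !mulr1n.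
Qed.


Lemma det0_colinear (F : fieldType) (x y : 'cV[F]_2) :
  y != 0 -> \det (row_mx x y : 'M_2) = 0 -> exists c, x = c *: y.
Proof.
rewrite col2_neq0 row_mx22 det_mx22E => y0 /eqP; rewrite subr_eq0 => /eqP e.
have eqcol (a b : 'cV[F]_2) : a 0 0 = b 0 0 -> a 1 0 = b 1 0 -> a = b.
  move=> e0 e1; apply/eqP; rewrite -subr_eq0; apply: contraTT isT.
  by rewrite col2_neq0 !mxE e0 e1 !subrr eqxx.
have [y00|y10] := orP y0.
  exists (x 0 0 / y 0 0); apply: eqcol; rewrite !mxE; first by field.
  by apply: (mulfI y00); rewrite -e; field.
exists (x 1 0 / y 1 0); apply: eqcol; rewrite !mxE; last by field.
by apply: (mulIf y10); rewrite e; field.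
Qed.

Lemma pair_row_inj (R : Type) : injective (@pair_row R).
Proof.
move=> [u1 u2] [v1 v2] /(@eq_row_mx _ 1 2 2 u1^T u2^T v1^T v2^T)[/trmx_inj -> /trmx_inj ->].
by [].
Qed.

Lemma pair_rowZ (R : pzRingType) (c : R) (u : 'cV[R]_2 * 'cV[R]_2) :
  pair_row (c *: u.1, c *: u.2) = c *: pair_row u.
Proof.
by rewrite /pair_row /= (scale_row_mx c u.1^T u.2^T) !linearZ.
Qed.

(** If [v.2] and [u.2] are independent, their images determine [t], and [\det t = 1] forces the two
    determinants to agree. Otherwise [v.2] is a multiple of [u.2], any valid [t] makes [v.1] the
    same multiple of [u.1], and the condition on [u] alone leaves at most [#|F|] matrices. *)
Lemma card_sl2_pair_transporter (F : finFieldType) (u v : 'cV[F]_2 * 'cV[F]_2) :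
  u.1 != 0 -> u.2 != 0 ->
  (#|[set t : 'M[F]_2 | [&& \det t == 1, t *m u.2 == u.1 & t *m v.2 == v.1]]%R|
   <= (pair_row v *m pair_form F *m (pair_row u)^T == 0)%R
      + (pair_row v <= pair_row u)%MS * #|F|)%N.
Proof.
move=> u1 u2; rewrite pair_formE; set T := [set t | _].
have hT t : t \in T -> t *m (row_mx v.2 u.2) = row_mx v.1 u.1 /\ \det t = 1.
  by rewrite inE => /and3P[/eqP dt /eqP eu /eqP ev]; rewrite mul_mx_row eu ev.
have [dY|dY] := eqVneq (\det (row_mx v.2 u.2 : 'M_2)) 0; last first.
  apply: leq_trans (leq_addr _ _).
  have [->|[t tT]] := set_0Vmem T; first by rewrite cards0.
  have <- : \det (row_mx v.1 u.1 : 'M_2) = \det (row_mx v.2 u.2 : 'M_2).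
    by have [<- dt] := hT _ tT; rewrite (det_mulmx t) dt mul1r.
  rewrite eqxx; apply/card_le1P => s sT r; rewrite [RHS]inE; apply/idP/eqP => [rT|->//].
  have [es _] := hT _ sT; have [er _] := hT _ rT.
  have uY : (row_mx v.2 u.2 : 'M_2) \in unitmx by rewrite unitmxE unitfE.
  by apply: (can_inj (mulmxK uY)); rewrite es er.
have [->|[t tT]] := set_0Vmem T; first by rewrite cards0.
apply: leq_trans (leq_addl _ _).
have [c ec] := det0_colinear u2 dY.
have -> : (pair_row v <= pair_row u)%MS.
  have ev : v.1 = c *: u.1.
    by move: tT; rewrite inE => /and3P[_ /eqP <- /eqP <-]; rewrite ec scalemxAr.
  by apply/sub_rVP; exists c; rewrite -pair_rowZ -ec -ev -surjective_pairing.
rewrite mul1n -(card_sl2_transporter u1 u2); apply/subset_leq_card/subsetP => s.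
by rewrite !inE => /and3P[-> ->].
Qed.

(** * Moments of the incidence function over SL_2 *)

Definition incident_pairs (R : pzSemiRingType) (F : finFieldType)
    (P : {set 'cV[F]_2 * 'cV[F]_2}) (t : 'M[F]_2) : R :=
  \sum_(u in P) (t *m u.2 == u.1)%:R.

Lemma sum_sl2_incident_pairs (R : pzSemiRingType) (F : finFieldType)
    (P : {set 'cV[F]_2 * 'cV[F]_2}) :
  (forall u, u \in P -> (u.1 != 0) && (u.2 != 0)) ->
  \sum_(t | \det t == 1) incident_pairs R P t = #|P|%:R * #|F|%:R.
Proof.
move=> P0; rewrite exchange_big /= mulr_natl -sumr_const; apply: eq_bigr => u uP.
have /andP[u1 u2] := P0 _ uP.
rewrite (sum_nat_of_bool R (fun t => \det t == 1)) -(card_sl2_transporter u1 u2).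
by congr _%:R; apply: eq_card => t; rewrite !inE.
Qed.

(** Expanding the square counts common incident matrices of ordered pairs [u], [v]. Proportional
    pairs cost [#|F| * k * #|P|], and the bound on orthogonal pairs contains this term once more,
    hence the factor 2. *)
Lemma sum_sl2_sqr_incident_pairs (R : realFieldType) (F : finFieldType)
    (P : {set 'cV[F]_2 * 'cV[F]_2}) (k : nat) :
  (forall u, u \in P -> (u.1 != 0) && (u.2 != 0)) ->
  (forall u, u \in P -> #|[set v in P | (pair_row v <= pair_row u)%MS]| <= k)%N ->
  \sum_(t | \det t == 1) incident_pairs R P t ^+ 2
    <= #|P|%:R ^+ 2 / #|F|%:R + 2 * (#|F|%:R * k%:R * #|P|%:R).
Proof.
move=> P0 hk.
pose Q := [set pair_row u | u in P].
have cQ : #|Q| = #|P| by rewrite card_imset //; apply: pair_row_inj.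
have Q0 : 0 \notin Q.
  apply/imsetP => -[u uP]; have /andP[u1 _] := P0 _ uP.
  case: u u1 {uP} => a b /= a0; rewrite /pair_row -(@row_mx0 _ 1 2 2).
  move/(@eq_row_mx _ 1 2 2)=> [/esym/eqP]; by rewrite trmx_eq0 (negPf a0).
have hkQ w : w \in Q -> (#|[set v in Q | (v <= w)%MS]| <= k)%N.
  case/imsetP => u uP ->; apply: leq_trans (hk _ uP).
  rewrite -(card_imset _ (@pair_row_inj F)); apply/subset_leq_card/subsetP => v.
  by rewrite inE => /andP[/imsetP[v' v'P ->] le]; apply: imset_f; rewrite inE v'P.
have := sum_incidence_count_on R (pair_form_unit F) Q0 hkQ.
rewrite cQ big_imset /=; last by move=> a b _ _; apply: pair_row_inj.
set W := \sum_(u in P) _ => hW.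
apply: (@le_trans _ _ (W + #|F|%:R * k%:R * #|P|%:R)); last by lra.
under eq_bigr => t _ do rewrite expr2 /incident_pairs big_distrlr /=.
rewrite exchange_big /=.
under eq_bigr => u _ do rewrite exchange_big /=.
have -> : #|F|%:R * k%:R * #|P|%:R = \sum_(u in P) #|F|%:R * k%:R :> R.
  by rewrite sumr_const mulr_natr.
have -> : W = \sum_(u in P) \sum_(v in P)
    (pair_row v *m pair_form F *m (pair_row u)^T == 0)%:R.
  rewrite exchange_big /=; apply: eq_bigr => v _.
  by rewrite /incidence_count big_imset //= => a b _ _; apply: pair_row_inj.
rewrite -big_split /=; apply: ler_sum => u uP.
have /andP[u1 u2] := P0 _ uP.
apply: (@le_trans _ _ (\sum_(v in P) ((pair_row v *m pair_form F *m (pair_row u)^T == 0)%:R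
     + (pair_row v <= pair_row u)%MS%:R * #|F|%:R))).
  apply: ler_sum => v vP.
  under eq_bigr => t _ do rewrite -natrM mulnb.
  rewrite (sum_nat_of_bool R (fun t => \det t == 1)) -natrM -natrD ler_nat.
  apply: leq_trans (card_sl2_pair_transporter v u1 u2).
  by apply/subset_leq_card/subsetP => t; rewrite !inE.
rewrite big_split /= -mulr_suml lerD2l sum_nat_of_bool [leLHS]mulrC ler_wpM2l //.
by rewrite ler_nat hk.
Qed.


(** * From the variance to the incidence bound *)

(** Cauchy-Schwarz, obtained from the nonnegativity of the squared deviations of [a] from its mean
    [X / s]. *)
Lemma sqr_sum_le (R : realFieldType) (T : finType) (S : {set T}) (a : T -> R) :
  (\sum_(i in S) a i) ^+ 2 <= #|S|%:R * \sum_(i in S) a i ^+ 2.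
Proof.
have [->|Sn0] := eqVneq S set0; first by rewrite !big_set0 expr0n mulr0.
set s : R := #|S|%:R; have s0 : 0 < s by rewrite ltr0n card_gt0.
set X := \sum_(i in S) a i.
have : 0 <= \sum_(i in S) (a i - X / s) ^+ 2 by apply: sumr_ge0 => i _; apply: sqr_ge0.
under eq_bigr => i _ do rewrite sqrrB.
rewrite big_split /= sumrB sumr_const sumrMnl -mulr_suml -/X -[(_ ^+ 2) *+ _]mulr_natl -/s.
set Y := \sum_(i in S) _ => H.
have : 0 <= s * (Y - X * (X / s) *+ 2 + s * (X / s) ^+ 2) by rewrite mulr_ge0 // ltW.
rewrite (_ : s * _ = s * Y - X ^+ 2); first by lra.
by field; lra.
Qed.

Lemma incidencesE (R : pzSemiRingType) p (P : {set 'cV['F_p]_2 * 'cV['F_p]_2})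
    (S : {set 'M['F_p]_2}) :
  (incidences P S)%:R = \sum_(t in S) incident_pairs R P t.
Proof.
rewrite exchange_big /= pair_big_dep /= /incidences -sum_nat_of_bool_all.
rewrite [RHS](big_mkcond _ _) /=; apply: eq_bigr => -[u t] _ /=.
by case: (u \in P); case: (t \in S).
Qed.

Lemma incidences_nonzero (R : realType) p (P : {set 'cV['F_p]_2 * 'cV['F_p]_2})
    (S : {set 'M['F_p]_2}) (k : nat) :
  prime p -> S \subset SL2 p ->
  (forall u, u \in P -> (u.1 != 0) && (u.2 != 0)) ->
  (forall u, u \in P -> #|[set v in P | (pair_row v <= pair_row u)%MS]| <= k)%N ->
  `| (incidences P S)%:R - #|P|%:R * #|S|%:R / p%:R ^+ 2 |
    <= 2 * (Num.sqrt p%:R * Num.sqrt k%:R * Num.sqrt (#|S|%:R * #|P|%:R)) :> R.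
Proof.
move=> pp SSL P0 hk.
have cF : #|'F_p| = p by rewrite card_Fp.
have SL1 := sum_sl2_incident_pairs R P0; rewrite cF in SL1.
have SL2 := sum_sl2_sqr_incident_pairs R P0 hk; rewrite cF in SL2.
rewrite incidencesE; set q : R := p%:R in SL1 SL2 *; set m : R := #|P|%:R in SL1 SL2 *.
set s : R := #|S|%:R; set f := incident_pairs R P in SL1 SL2 *.
have q0 : 0 < q by rewrite ltr0n prime_gt0.
have qn0 : q != 0 by rewrite lt0r_neq0.
have -> : \sum_(t in S) f t - m * s / q ^+ 2 = \sum_(t in S) (f t - m / q ^+ 2).
  by rewrite sumrB sumr_const -[(_ / _) *+ _]mulr_natl -/s; ring.
set X := \sum_(t in S) _.
(* The terms [m ^+ 2 / q] cancel: one from the second moment, minus two from the cross term, and at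
   most one from the constant term since SL_2 has at most [q ^+ 3] elements. *)
have hV : \sum_(t | \det t == 1) (f t - m / q ^+ 2) ^+ 2 <= 2 * (q * k%:R * m).
  have Sc : \sum_(t : 'M['F_p]_2 | \det t == 1) (m / q ^+ 2) ^+ 2 <= m ^+ 2 / q.
    rewrite (_ : m ^+ 2 / q = q ^+ 3 * (m / q ^+ 2) ^+ 2); last by field.
    rewrite sumr_const -mulr_natl ler_wpM2r ?sqr_ge0 // /q -natrX ler_nat.
    have := card_sl2_le 'F_p; rewrite cF; apply: leq_trans.
    by apply/subset_leq_card/subsetP => t; rewrite !inE.
  under eq_bigr => t _ do rewrite sqrrB.
  rewrite big_split /= sumrB sumrMnl -mulr_suml SL1.
  have -> : m * q * (m / q ^+ 2) = m ^+ 2 / q by field.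
  by clear cF; lra.
(* After Cauchy-Schwarz on [S], nonnegativity of squares lets the sum be extended to all of SL_2. *)
have hX : X ^+ 2 <= s * (2 * (q * k%:R * m)).
  apply: le_trans (sqr_sum_le _ _) _; rewrite ler_wpM2l //; apply: le_trans hV.
  rewrite big_mkcond [leRHS]big_mkcond /=; apply: ler_sum => t _.
  case: ifP => [tS|_]; last by case: ifP => // _; apply: sqr_ge0.
  by have := subsetP SSL _ tS; rewrite inE => ->.
rewrite -!sqrtrM ?mulr_ge0 ?(ltW q0) //.
(* The variance yields a factor [Num.sqrt 2], which is rounded up to 2. *)
have s2 : 2 = Num.sqrt (2 ^+ 2) :> R by rewrite sqrtr_sqr ger0_norm.
rewrite -sqrtr_sqr [X in X * _]s2 -sqrtrM ?sqr_ge0 //. apply: ler_wsqrtr.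
apply: le_trans hX _.
have : 0 <= q * k%:R * (s * m) by rewrite !mulr_ge0 // ltW.
by clear cF; lra.
Qed.

(** * Discarding zero vectors *)

(** An invertible matrix sends only zero to zero, so an incident pair with one zero component has
    both zero. *)
Lemma incidences_zero_le p (P : {set 'cV['F_p]_2 * 'cV['F_p]_2}) (t : 'M['F_p]_2) :
  \det t = 1 ->
  (#|[set u in P | ~~ ((u.1 != 0) && (u.2 != 0)) & t *m u.2 == u.1]%R| <= 1)%N.
Proof.
move=> dt; rewrite -[leqRHS](cards1 (0 : 'cV['F_p]_2, 0 : 'cV['F_p]_2)).
apply/subset_leq_card/subsetP => -[x y]; rewrite !inE /= => /and3P[_ xy /eqP txy].
have ut : t \in unitmx by rewrite unitmxE dt unitr1.
have xy0 : (x == 0) = (y == 0).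
  by rewrite -txy -{1}(mulmx0 _ t) (inj_eq (can_inj (mulKmx ut))).
by move: xy; rewrite xpair_eqE xy0 andbb negbK => ->.
Qed.

(* Pairs with a zero component carry at most the incidences of (0, 0), and
   there are at most 2 p^2 of them: both effects are O(|S|). *)
Lemma incidences_remove_zero (R : realType) p (P : {set 'cV['F_p]_2 * 'cV['F_p]_2})
    (S : {set 'M['F_p]_2}) :
  prime p -> S \subset SL2 p ->
  `| (incidences P S)%:R - #|P|%:R * #|S|%:R / p%:R ^+ 2 |
   <= `| (incidences [set u in P | (u.1 != 0%R) && (u.2 != 0%R)] S)%:R
         - #|[set u in P | (u.1 != 0%R) && (u.2 != 0%R)]|%:R * #|S|%:R / p%:R ^+ 2 |
      + 2 * #|S|%:R :> R.
Proof.
move=> pp SSL; set P' := [set u in P | (u.1 != 0) && _].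
pose Z := [set u in P | ~~ ((u.1 != 0) && (u.2 != 0))].
have q0 : 0 < p%:R :> R by rewrite ltr0n prime_gt0.
have PI : P :&: [set u | (u.1 != 0) && (u.2 != 0)] = P'.
  by apply/setP => u; rewrite !inE.
have PD : P :\: [set u | (u.1 != 0) && (u.2 != 0)] = Z.
  by apply/setP => u; rewrite !inE andbC.
have cP : #|P|%:R = #|P'|%:R + #|Z|%:R :> R.
  by rewrite -natrD -PI -PD cardsID.
have cZ : #|Z|%:R <= 2 * p%:R ^+ 2 :> R.
  rewrite -natrX -natrM ler_nat.
  have c2 : #|[set: 'cV['F_p]_2]| = (p ^ 2)%N by rewrite cardsT card_mx card_Fp.
  have -> : (2 * p ^ 2 = #|setX [set (0%R : 'cV['F_p]_2)] [set: 'cV['F_p]_2]|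
      + #|setX [set: 'cV['F_p]_2] [set (0%R : 'cV['F_p]_2)]|)%N.
    by rewrite !cardsX cards1 c2 mul1n muln1 addnn mul2n.
  apply: leq_trans (leq_card_setU _ _); apply/subset_leq_card/subsetP => u.
  by rewrite !inE => /andP[_]; rewrite negb_and !negbK andbT.
have If : (incidences P S)%:R = (incidences P' S)%:R + \sum_(t in S) incident_pairs R Z t :> R.
  rewrite !incidencesE -big_split /=; apply: eq_bigr => t _.
  by rewrite /incident_pairs (big_setID [set u | (u.1 != 0) && (u.2 != 0)]) /= PI PD.
have I0 : 0 <= \sum_(t in S) incident_pairs R Z t.
  by apply: sumr_ge0 => t _; apply: sumr_ge0.
have I1 : \sum_(t in S) incident_pairs R Z t <= #|S|%:R.
  rewrite -sumr_const; apply: ler_sum => t tS.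
  have dt : \det t = 1 by have := subsetP SSL _ tS; rewrite inE => /eqP.
  rewrite /incident_pairs (sum_nat_of_bool R Z (fun u => t *m u.2 == u.1)) lern1.
  apply: leq_trans (incidences_zero_le P dt); apply/subset_leq_card/subsetP => u.
  by rewrite !inE -andbA.
rewrite If cP.
set I := \sum_(t in S) _ in I0 I1 *; set s : R := #|S|%:R in I1 *.
have d0 : 0 <= #|Z|%:R * s / p%:R ^+ 2 by rewrite !mulr_ge0 // invr_ge0 sqr_ge0.
have d2 : #|Z|%:R * s / p%:R ^+ 2 <= 2 * s.
  rewrite ler_pdivrMr ?exprn_gt0 // mulrAC ler_wpM2r //.
rewrite (_ : _ - _ = ((incidences P' S)%:R - #|P'|%:R * s / p%:R ^+ 2)
   + (I - #|Z|%:R * s / p%:R ^+ 2)); last by ring.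
apply: le_trans (ler_normD _ _) _; rewrite lerD2l ler_norml.
by apply/andP; split; lra.
Qed.

(** * Points on lines through the origin and the final bounds *)

(** A multiple of [pair_row u] scales both components by one scalar. Counting scalars instead of
    pairs lets either factor of a product set bound them. *)
Lemma card_line_le (F : finFieldType) (P : {set 'cV[F]_2 * 'cV[F]_2})
    (u : 'cV[F]_2 * 'cV[F]_2) :
  (#|[set v in P | (pair_row v <= pair_row u)%MS]|
   <= #|[set c : F | (c *: u.1, c *: u.2) \in P]|)%N.
Proof.
apply: leq_trans (leq_imset_card (fun c => (c *: u.1, c *: u.2)) _).
apply/subset_leq_card/subsetP => v; rewrite inE => /andP[vP /sub_rVP[c]].
by rewrite -pair_rowZ => /pair_row_inj ev; apply/imsetP; exists c; rewrite // inE -ev.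
Qed.

(** Scaling [x] embeds the scalars into the line spanned by [x]. *)
Lemma card_scalars_le_max (p : nat) (A : {set 'cV['F_p]_2}) (k : nat) (x : 'cV['F_p]_2) :
  x != 0 -> is_max_on_line A k -> (#|[set c : 'F_p | (c *: x)%R \in A]| <= k)%N.
Proof.
move=> x0 [_ /(_ <[x]>%VS)]; rewrite dim_vline x0 => /(_ erefl); apply: leq_trans.
have inj : injective (fun c : 'F_p => c *: x).
  move=> c d /eqP; rewrite -subr_eq0 -scalerBl scaler_eq0 (negPf x0) orbF subr_eq0.
  by move/eqP.
rewrite -(card_imset _ inj); apply/subset_leq_card/subsetP => y /imsetP[c].
by rewrite !inE => cA ->; rewrite cA memvZ // memv_line.
Qed.

(** Removing the pairs with a zero component only shrinks the scalar sets and [P], and its cost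
    [2 * #|S|] fits the same constant 2. *)
Lemma incidences_bound (R : realType) p (P : {set 'cV['F_p]_2 * 'cV['F_p]_2})
    (S : {set 'M['F_p]_2}) (k : nat) :
  prime p -> S \subset SL2 p ->
  (forall u, u \in P -> u.1 != 0%R -> u.2 != 0%R ->
    #|[set c : 'F_p | (c *: u.1, c *: u.2)%R \in P]| <= k)%N ->
  `| (incidences P S)%:R - #|P|%:R * #|S|%:R / p%:R ^+ 2 |
    <= 2 * (Num.sqrt p%:R * Num.sqrt k%:R * Num.sqrt (#|S|%:R * #|P|%:R) + #|S|%:R) :> R.
Proof.
move=> pp SSL hk.
apply: le_trans (incidences_remove_zero R P pp SSL) _.
rewrite mulrDr lerD2r; set P' := [set u in P | _].
have P'P : P' \subset P by apply/subsetP => u; rewrite inE => /andP[].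
have P0 u : u \in P' -> (u.1 != 0) && (u.2 != 0) by rewrite inE => /andP[].
have hk' u : u \in P' -> (#|[set v in P' | (pair_row v <= pair_row u)%MS]| <= k)%N.
  move=> uP; have /andP[u1 u2] := P0 _ uP.
  apply: leq_trans (card_line_le _ _) _.
  apply: leq_trans (hk u (subsetP P'P _ uP) u1 u2).
  by apply/subset_leq_card/subsetP => c; rewrite !inE => /andP[].
apply: le_trans (incidences_nonzero R pp SSL P0 hk') _.
rewrite ler_wpM2l // ler_wpM2l ?mulr_ge0 ?sqrtr_ge0 // ler_wsqrtr // ler_wpM2l //.
by rewrite ler_nat subset_leq_card.
Qed.

Theorem theorem2p1 (R : realType) :
  (exists C : R, 0 < C /\
     forall (p : nat) (A B : {set 'cV['F_p]_2}) (S : {set 'M['F_p]_2}),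
       prime p -> odd p -> S \subset SL2 p ->
       let P := setX A B in
       `| (incidences P S)%:R - #|P|%:R * #|S|%:R / p%:R ^+ 2 |
         <= C * (p%:R * Num.sqrt (#|S|%:R * #|P|%:R) + #|S|%:R)) /\
  (exists C : R, 0 < C /\
     forall (p : nat) (A B : {set 'cV['F_p]_2}) (S : {set 'M['F_p]_2})
            (kA kB : nat),
       prime p -> odd p -> S \subset SL2 p ->
       is_max_on_line A kA -> is_max_on_line B kB ->
       let P := setX A B in
       let k := minn kA kB in
       `| (incidences P S)%:R - #|P|%:R * #|S|%:R / p%:R ^+ 2 |
         <= C * (Num.sqrt p%:R * Num.sqrt k%:R * Num.sqrt (#|S|%:R * #|P|%:R)
                 + #|S|%:R)).
Proof.
split; exists 2; split=> // p A B S.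
  move=> pp _ SSL; cbv zeta.
  (* The first bound is the case [k = p], since there are only [p] scalars. *)
  have e : p%:R = Num.sqrt p%:R * Num.sqrt p%:R :> R by rewrite -expr2 sqr_sqrtr.
  rewrite [X in 2 * (X * _ + _)]e.
  apply: incidences_bound => // u _ _ _.
  by rewrite -[leqRHS]card_Fp // max_card.
move=> kA kB pp _ SSL maxA maxB; cbv zeta; apply: incidences_bound => // u _ u1 u2.
(* A scalar keeping [u] in the product keeps [u.1] in [A] and [u.2] in [B], so both maxima bound the
   number of scalars. *)
rewrite leq_min; apply/andP; split.
  apply: leq_trans (card_scalars_le_max u1 maxA).
  by apply/subset_leq_card/subsetP => c; rewrite !inE => /andP[].
apply: leq_trans (card_scalars_le_max u2 maxB).
by apply/subset_leq_card/subsetP => c; rewrite !inE => /andP[].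
Qed.
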